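(* Let $\mathcal{A}=(\mathbf{A}_1,\mathbf{A})$ be a quantum space with algebra structure $(m,\eta)$, let $\psi\in\mathfrak{Z}^2[\mathbf{A}_1]$ be an $\mathcal{A}$-admissible counital 2-cocycle, and let $\Psi:\mathbf{A}\otimes\mathbf{A}\to\mathbf{A}\otimes\mathbf{A}$ be the linear map defined by $\psi$, i.e. $\Psi\,\Pi^{\otimes2}=\Pi^{\otimes2}\,\psi$. Then $m_\psi=m\,\Psi$ is an associative product with unit $\eta$, and the associative unital algebra $\mathbf{A}_\psi=(\mathbf{A},m_\psi,\eta)$ is also generated by $\mathbf{A}_1$. Moreover, $m_\psi$ defines a filtration (the one whose $n$-th term is spanned by the $m_\psi$-products of at most $n$ elements of $\mathbf{A}_1$) that coincides with the filtration $\mathbf{F}_n=\Pi\big(\bigoplus_{i=0}^n\mathbf{A}_1^{\otimes i}\big)$ associated to $m$. In particular, if $\mathcal{A}$ is conic, $m_\psi$ defines the same gradation as $m$.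
   Context: $\Bbbk$ is $\mathbb{R}$ or $\mathbb{C}$. A quantum space (object of $\mathrm{FGA}$) is a pair $\mathcal{A}=(\mathbf{A}_1,\mathbf{A})$ with $\mathbf{A}$ a unital associative $\Bbbk$-algebra generated by a finite-dimensional linear subspace $\mathbf{A}_1\subset\mathbf{A}$. $\Pi:\mathbf{A}_1^\otimes\twoheadrightarrow\mathbf{A}$ is the canonical algebra epimorphism from the tensor algebra $\mathbf{A}_1^{\otimes}=\bigoplus_{n\ge 0}\mathbf{A}_1^{\otimes n}$ restricting to the inclusion on $\mathbf{A}_1$. $\mathcal{A}$ is conic if $\ker\Pi$ is a graded ideal $\bigoplus_n\mathbf{I}_n$, $\mathbf{I}_n\subset\mathbf{A}_1^{\otimes n}$; then $\mathbf{A}$ is graded by $\mathbf{A}_n=\Pi(\mathbf{A}_1^{\otimes n})$. For a vector space $\mathbf{V}$, a 2-cochain $\psi\in\mathsf{C}^2[\mathbf{V}]$ is a linear automorphism of $\mathbf{V}^\otimes\otimes\mathbf{V}^\otimes$ with $\psi(\mathbf{V}^{\otimes r}\otimes\mathbf{V}^{\otimes s})=\mathbf{V}^{\otimes r}\otimes\mathbf{V}^{\otimes s}$ for all $r,s\in\mathbb{N}_0$; $\psi_{r,s}$ is its restriction. With the identifications $\mathbf{V}^{\otimes r}\otimes\mathbf{V}^{\otimes s}\cong\mathbf{V}^{\otimes r+s}$ given by multiplication, $\psi$ is a 2-cocycle if $\psi_{r+s,t}(\psi_{r,s}\otimes id_t)=\psi_{r,s+t}(id_r\otimes\psi_{s,t})$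 on $\mathbf{V}^{\otimes r}\otimes\mathbf{V}^{\otimes s}\otimes\mathbf{V}^{\otimes t}$ for all $r,s,t$ (where e.g. $\psi_{r+s,t}$ is transported through the identification of the first two factors with $\mathbf{V}^{\otimes r+s}$). It is counital if $\psi(1\otimes a)=1\otimes a$ and $\psi(a\otimes1)=a\otimes1$ for all $a$. $\mathfrak{Z}^2[\mathbf{V}]$ is the set of counital 2-cocycles. $\psi\in\mathsf{C}^2[\mathbf{A}_1]$ is $\mathcal{A}$-admissible if $\psi(\ker\Pi^{\otimes2})=\ker\Pi^{\otimes2}$, where $\Pi^{\otimes 2}=\Pi\otimes\Pi$. *)

(* Defs.v *)
From HB Require Import structures.
From mathcomp Require Import all_boot all_order all_algebra.
From mathcomp Require Import boolp classical_sets reals.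
From mathcomp Require Export complex.

Set Implicit Arguments.
Unset Strict Implicit.
Unset Printing Implicit Defensive.

Import GRing.Theory.

Local Open Scope ring_scope.
Local Open Scope quotient_scope.
Local Open Scope classical_set_scope.

(* The module presented by generators and relations.  The relations are given
   through the class [ok] of the maps that satisfy them, and two formal linear
   combinations of generators are identified when no such map separates them;
   for relations stating equalities between linear combinations this is the
   quotient of the free module by the span of the relations. *)
Section Presentation.
Variables (k : fieldType) (X : choiceType).
Variable ok : forall W : lmodType k, (X -> W) -> Prop.

Definition peval (W : lmodType k) (f : X -> W) (s : seq (k * X)) : W :=
  \sum_(p <- s) p.1 *: f p.2.

Definition pequiv : rel (seq (k * X)) := fun s t =>
  `[< forall (W : lmodType k) (f : X -> W), ok f -> peval f s = peval f t >].

Lemma pequiv_refl : reflexive pequiv.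
Proof. by move=> s; apply/asboolP. Qed.

Lemma pequiv_sym : symmetric pequiv.
Proof.
by move=> s t; apply/asboolP/asboolP => h W f hf; rewrite (h W f hf).
Qed.

Lemma pequiv_trans : transitive pequiv.
Proof.
move=> t s u /asboolP h1 /asboolP h2; apply/asboolP => W f hf.
by rewrite (h1 W f hf) (h2 W f hf).
Qed.

Canonical pequiv_equiv := EquivRel pequiv pequiv_refl pequiv_sym pequiv_trans.

Definition presented := {eq_quot pequiv_equiv}.
HB.instance Definition _ := Choice.on presented.

Definition pclass (s : seq (k * X)) : presented := \pi_presented s.
Definition plift (W : lmodType k) (f : X -> W) (x : presented) : W :=
  peval f (repr x).

Lemma plift_class (W : lmodType k) (f : X -> W) s :
  ok f -> plift f (pclass s) = peval f s.
Proof.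
by move=> hf; rewrite /plift /pclass; case: piP => t /eqmodP/asboolP/(_ W f hf).
Qed.

Lemma presentedP (x y : presented) :
  (forall (W : lmodType k) (f : X -> W), ok f -> plift f x = plift f y) ->
  x = y.
Proof.
move=> h; rewrite -[x]reprK -[y]reprK; apply/eqmodP/asboolP => W f hf.
exact: h.
Qed.

Definition pzero : presented := pclass [::].
Definition padd (x y : presented) : presented := pclass (repr x ++ repr y).
Definition pscale (a : k) (x : presented) : presented :=
  pclass [seq (a * p.1, p.2) | p <- repr x].
Definition popp (x : presented) : presented := pscale (- 1) x.

Lemma plift0 (W : lmodType k) (f : X -> W) : ok f -> plift f pzero = 0.
Proof. by move=> hf; rewrite plift_class // /peval big_nil. Qed.

Lemma pliftD (W : lmodType k) (f : X -> W) x y :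
  ok f -> plift f (padd x y) = plift f x + plift f y.
Proof. by move=> hf; rewrite plift_class // /peval big_cat. Qed.

Lemma pliftZ (W : lmodType k) (f : X -> W) a x :
  ok f -> plift f (pscale a x) = a *: plift f x.
Proof.
move=> hf; rewrite plift_class // /peval big_map scaler_sumr.
by apply: eq_bigr => p _; rewrite scalerA.
Qed.

Let pliftE W f hf :=
  (@plift0 W f hf, fun x y => @pliftD W f x y hf, fun a x => @pliftZ W f a x hf).

Fact paddA : associative padd.
Proof. by move=> x y z; apply: presentedP => W f hf; rewrite !pliftE // addrA. Qed.
Fact paddC : commutative padd.
Proof. by move=> x y; apply: presentedP => W f hf; rewrite !pliftE // addrC. Qed.
Fact padd0 : left_id pzero padd.
Proof. by move=> x; apply: presentedP => W f hf; rewrite !pliftE // add0r. Qed.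
Fact paddN : left_inverse pzero popp padd.
Proof.
by move=> x; apply: presentedP => W f hf; rewrite !pliftE // scaleN1r addNr.
Qed.

HB.instance Definition _ :=
  GRing.isZmodule.Build presented paddA paddC padd0 paddN.

Fact pscaleA a b x : pscale a (pscale b x) = pscale (a * b) x.
Proof. by apply: presentedP => W f hf; rewrite !pliftE // scalerA. Qed.
Fact pscale1 : left_id 1 pscale.
Proof. by move=> x; apply: presentedP => W f hf; rewrite !pliftE // scale1r. Qed.
Fact pscaleDr : right_distributive pscale +%R.
Proof. by move=> a x y; apply: presentedP => W f hf; rewrite !pliftE // scalerDr. Qed.
Fact pscaleDl x : {morph pscale^~ x : a b / a + b}.
Proof. by move=> a b; apply: presentedP => W f hf; rewrite !pliftE // scalerDl. Qed.

HB.instance Definition _ := GRing.Zmodule_isLmodule.Build k presented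
  pscaleA pscale1 pscaleDr pscaleDl.

Definition pgen (x : X) : presented := pclass [:: (1, x)].

Lemma plift_gen (W : lmodType k) (f : X -> W) x : ok f -> plift f (pgen x) = f x.
Proof. by move=> hf; rewrite plift_class // /peval big_seq1 scale1r. Qed.

Lemma plift_linear (W : lmodType k) (f : X -> W) : ok f -> linear (plift f).
Proof. by move=> hf a x y; rewrite pliftD // pliftZ. Qed.

Lemma pgen_span (x : presented) : x = \sum_(p <- repr x) p.1 *: pgen p.2.
Proof.
apply: presentedP => W f hf.
have -> : forall s, plift f (\sum_(p <- s) p.1 *: pgen p.2) = peval f s.
  elim=> [|p s IHs]; first by rewrite /peval !big_nil plift0.
  by rewrite big_cons pliftD // pliftZ // plift_gen // IHs /peval big_cons.
by [].
Qed.

End Presentation.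

Section TensorProduct.
Variables (k : fieldType) (U V : lmodType k).

Definition is_bilinear (W : lmodType k) (f : U -> V -> W) : Prop :=
  (forall v, linear (f^~ v)) /\ (forall u, linear (f u)).

Definition tensor : lmodType k :=
  presented (fun W (f : U * V -> W) => is_bilinear (fun u v => f (u, v))).

Definition tens (u : U) (v : V) : tensor := pgen _ (u, v).

(* The linear map induced by the bilinear map [f]. *)
Definition tlift (W : lmodType k) (f : U -> V -> W) : tensor -> W :=
  plift (fun p => f p.1 p.2).

Lemma tens_bilinear : is_bilinear tens.
Proof.
by split=> [v a x y | u a x y]; apply: presentedP => W f hf;
  rewrite plift_linear // !plift_gen //; case: hf => hl hr; rewrite (hl, hr).
Qed.

Lemma tlift_tens (W : lmodType k) (f : U -> V -> W) u v :
  is_bilinear f -> tlift f (tens u v) = f u v.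
Proof. by move=> hf; rewrite /tlift plift_gen. Qed.

Lemma tlift_linear (W : lmodType k) (f : U -> V -> W) :
  is_bilinear f -> linear (tlift f).
Proof. by move=> hf; apply: plift_linear. Qed.

Lemma tens_span (z : tensor) : exists s : seq (U * V),
  z = \sum_(p <- s) tens p.1 p.2.
Proof.
exists [seq (p.1 *: p.2.1, p.2.2) | p <- repr z].
rewrite {1}[z]pgen_span big_map; apply: eq_bigr => -[a [u v]] _ /=.
have [hl _] := tens_bilinear; have := hl v a u 0.
rewrite addr0 => ->; have := hl v (- 1) u u.
by rewrite scaleN1r addNr scaleN1r addNr => ->; rewrite addr0.
Qed.

End TensorProduct.

(* f (x) g *)
Definition tmap (k : fieldType) (U V U' V' : lmodType k)
    (f : U -> U') (g : V -> V') : tensor U V -> tensor U' V' :=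
  tlift (fun u v => tens (f u) (g v)).

(* The tensor algebra; a generator is a word [:: v1; ...; vn], standing for
   v1 (x) ... (x) vn, subject to linearity in each letter. *)
Section TensorAlgebra.
Variables (k : fieldType) (V : lmodType k).

Definition is_multilinear (W : lmodType k) (f : seq V -> W) : Prop :=
  forall s t, linear (fun v => f (s ++ v :: t)).

Definition talg : lmodType k := presented is_multilinear.

Definition tword (s : seq V) : talg := pgen is_multilinear s.

Definition talift (W : lmodType k) (f : seq V -> W) : talg -> W := plift f.

Definition tone : talg := tword [::].
Definition tmul (x y : talg) : talg :=
  talift (fun s => talift (fun t => tword (s ++ t)) y) x.

Lemma tword_multilinear : is_multilinear tword.
Proof.
move=> s t a v w; apply: presentedP => W f hf.
by rewrite plift_linear // !plift_gen // hf.
Qed.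

Lemma talift_word (W : lmodType k) (f : seq V -> W) s :
  is_multilinear f -> talift f (tword s) = f s.
Proof. exact: plift_gen. Qed.

Lemma talift_linear (W : lmodType k) (f : seq V -> W) :
  is_multilinear f -> linear (talift f).
Proof. exact: plift_linear. Qed.

Lemma tword_span (x : talg) : exists s : seq (k * seq V),
  x = \sum_(p <- s) p.1 *: tword p.2.
Proof. by exists (repr x); exact: pgen_span. Qed.

Lemma tmul_word s t : tmul (tword s) (tword t) = tword (s ++ t).
Proof.
have h u : is_multilinear (fun t => tword (u ++ t)).
  by move=> s' t' a v w; rewrite !catA tword_multilinear.
rewrite /tmul talift_word ?talift_word // => s' t' a v w.
by rewrite !talift_word // -!catA /= tword_multilinear.
Qed.

End TensorAlgebra.

Section Subspaces.
Variables (k : fieldType) (W : lmodType k).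

Definition subspace (S : set W) : Prop :=
  S 0 /\ forall (a : k) x y, S x -> S y -> S (a *: x + y).

Definition lspan (S : set W) : set W := smallest subspace S.

Definition direct_sum (P : set W) (S : nat -> set W) : Prop :=
  [/\ forall n, subspace (S n),
      P = lspan (\bigcup_n S n)
    & forall (N : nat) (x : 'I_N -> W), (forall i : 'I_N, S i (x i)) ->
        \sum_(i < N) x i = 0 -> forall i : 'I_N, x i = 0].

End Subspaces.

Definition lker (k : fieldType) (W W' : lmodType k) (f : W -> W') : set W :=
  [set x | f x = 0].

(* The subspace V^(x)n of the tensor algebra of V. *)
Definition tpow (k : fieldType) (V : lmodType k) (n : nat) : set (talg V) :=
  lspan [set tword s | s in [set s | size s = n]].
Arguments tpow {k} V n.

(* The subspace V^(x)r (x) V^(x)s of the tensor square of the tensor algebra. *)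
Definition tpow2 (k : fieldType) (V : lmodType k) (r s : nat) :
    set (tensor (talg V) (talg V)) :=
  lspan [set tens x y | x in tpow V r & y in tpow V s].
Arguments tpow2 {k} V r s.

(* A vector space A with a product [mul] and a unit [one]; a product is not
   attached to the type A, as two of them are to be considered on the same A
   (and [algType] would also exclude the zero algebra). *)
Section Algebras.
Variables (k : fieldType) (A : lmodType k) (mul : A -> A -> A) (one : A).

Definition is_algebra : Prop :=
  [/\ is_bilinear mul, associative mul, left_id one mul & right_id one mul].

Definition subalgebra (S : set A) : Prop :=
  [/\ subspace S, S one & forall x y, S x -> S y -> S (mul x y)].

Definition is_filtration (F : nat -> set A) : Prop :=
  [/\ forall n, subspace (F n),
      forall n, F n `<=` F n.+1,
      \bigcup_n F n = [set: A],
      F 0 one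
    & forall r s x y, F r x -> F s y -> F (r + s)%N (mul x y)].

Definition is_gradation (G : nat -> set A) : Prop :=
  [/\ direct_sum [set: A] G,
      G 0 one
    & forall r s x y, G r x -> G s y -> G (r + s)%N (mul x y)].

Variables (V : vectType k) (inc : {linear V -> A}).

(* inc identifies V with a linear subspace A_1 of A. *)
Definition quantum_space : Prop :=
  [/\ is_algebra, injective inc & smallest subalgebra (range inc) = [set: A]].

Definition word_prod (s : seq V) : A := foldr (fun v a => mul (inc v) a) one s.

(* The canonical map Pi from the tensor algebra of A_1 to A. *)
Definition canon_epi : talg V -> A := talift word_prod.

Definition prod_filtration (n : nat) : set A :=
  lspan [set word_prod s | s in [set s | (size s <= n)%N]].

Definition canon_filtration (n : nat) : set A :=
  canon_epi @` lspan (\bigcup_(i in [set i | (i <= n)%N]) tpow V i).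

Definition canon_component (n : nat) : set A := canon_epi @` tpow V n.

Definition conic : Prop :=
  exists I : nat -> set (talg V),
    (forall n, I n `<=` tpow V n) /\ direct_sum (lker canon_epi) I.

End Algebras.

Lemma talg_algebra (k : fieldType) (V : lmodType k) :
  is_algebra (@tmul k V) (tone V).
Proof.
have hR u : is_multilinear (fun t : seq V => tword (u ++ t)).
  by move=> s t a v w; rewrite !catA tword_multilinear.
have hL y : is_multilinear (fun s => talift (fun t : seq V => tword (s ++ t)) y).
  move=> s t a v w; rewrite {1 2 3}[y]pgen_span.
  have E u : talift (fun t : seq V => tword (u ++ t)) y =
      \sum_(p <- repr y) p.1 *: tword (u ++ p.2) by [].
  rewrite -[X in talift _ X]pgen_span -[X in _ *: talift _ X + _]pgen_span.
  rewrite -[X in _ + talift _ X]pgen_span !E scaler_sumr -big_split /=.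
  apply: eq_bigr => p _; rewrite -!catA /= tword_multilinear scalerDr !scalerA.
  by rewrite [p.1 * a]mulrC.
have hmul : is_bilinear (@tmul k V).
  split=> [y | x]; first exact: talift_linear.
  move=> a y z; have E u : tmul x u =
      \sum_(p <- repr x) p.1 *: talift (fun t : seq V => tword (p.2 ++ t)) u by [].
  rewrite !E scaler_sumr -big_split; apply: eq_bigr => p _ /=.
  by rewrite talift_linear // scalerDr !scalerA [p.1 * a]mulrC.
have [hl hr] := hmul.
have lin0 (W : lmodType k) (f : W -> talg V) : linear f -> f 0 = 0.
  by move=> hf; have := hf (- 1) 0 0; rewrite scaleN1r addNr scaleN1r addNr.
have lin_ext (f g : talg V -> talg V) : linear f -> linear g ->
    (forall s, f (tword s) = g (tword s)) -> f =1 g.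
  move=> hf hg fg x; have [s ->] := tword_span x.
  elim: s => [|p s IHs]; first by rewrite big_nil !lin0.
  by rewrite big_cons hf hg fg IHs.
have lin_id : linear (@id (talg V)) by [].
split=> //.
- move=> x y z; move: x; apply: (lin_ext _ _) => [a u v | a u v | s].
  + exact: hl.
  + by rewrite !hl.
  move: y; apply: (lin_ext _ _) => [a u v | a u v | t]; [by rewrite hl hr | by rewrite hr hl |].
  move: z; apply: (lin_ext _ _) => [a u v | a u v | u]; [by rewrite !hr | exact: hr |].
  by rewrite !tmul_word catA.
- by apply: (lin_ext _ _) => // s; rewrite tmul_word.
- by apply: (lin_ext _ _) => // s; rewrite tmul_word cats0.
Qed.

Section Cochains.
Variables (k : fieldType) (V : lmodType k).

Notation T := (talg V).
Notation TT := (tensor T T).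

(* Multiplication T (x) T -> T; it identifies V^(x)r (x) V^(x)s with
   V^(x)(r+s). *)
Definition tjoin : TT -> T := tlift (@tmul k V).

Definition cochain2 (psi : {linear TT -> TT}) : Prop :=
  bijective psi /\ forall r s, psi @` tpow2 V r s = tpow2 V r s.

(* psi_{r+s,t} (psi_{r,s} (x) id_t) = psi_{r,s+t} (id_r (x) psi_{s,t}) on the
   pure tensors, which span V^(x)r (x) V^(x)s (x) V^(x)t; the inner [tjoin] is
   the transport to V^(x)(r+s) (x) V^(x)t or V^(x)r (x) V^(x)(s+t), and the
   outer one compares the values in V^(x)(r+s+t). *)
Definition cocycle2 (psi : {linear TT -> TT}) : Prop :=
  forall (r s t : nat) (x y z : T), tpow V r x -> tpow V s y -> tpow V t z ->
    tjoin (psi (tmap tjoin id (tmap psi id (tens (tens x y) z)))) =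
    tjoin (psi (tmap id tjoin (tmap id psi (tens x (tens y z))))).

Definition counital (psi : {linear TT -> TT}) : Prop :=
  forall a : T, psi (tens (tone V) a) = tens (tone V) a /\
                psi (tens a (tone V)) = tens a (tone V).

Definition counital_cocycle2 (psi : {linear TT -> TT}) : Prop :=
  [/\ cochain2 psi, cocycle2 psi & counital psi].

Variables (A : lmodType k) (Pi : T -> A).

Definition admissible (psi : {linear TT -> TT}) : Prop :=
  psi @` lker (tmap Pi Pi) = lker (tmap Pi Pi).

Definition induced (psi : {linear TT -> TT})
    (Psi : {linear tensor A A -> tensor A A}) : Prop :=
  forall z : TT, Psi (tmap Pi Pi z) = tmap Pi Pi (psi z).

End Cochains.

(* m Psi, as a binary operation. *)
Definition twisted (k : fieldType) (A : lmodType k) (mul : A -> A -> A)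
    (Psi : tensor A A -> tensor A A) (a b : A) : A :=
  tlift mul (Psi (tens a b)).

(* Main.v *)
From HB Require Import structures.
Require Import Defs.
From mathcomp Require Import all_boot all_order all_algebra.
From mathcomp Require Import boolp classical_sets reals.

(** Write [T] for the tensor algebra of [A1], [Pi : T -> A] for the canonical
map, and [star x y] for the product of the two factors of [psi (x (x) y)].

The idea is to twist the free algebra first.  Once the identifications
V^(x)r (x) V^(x)s = V^(x)(r+s) are made explicit, the cocycle identity at
[x (x) y (x) z] says exactly that [star] associates on [x], [y], [z], and
counitality says that the empty word is its unit ([star_algebra]).  So
[(T, star)] is an algebra, and [Pi (star x y) = mpsi (Pi x) (Pi y)]
([twisted_canon_epi]), since [Psi] is defined by passing [psi] to the quotient.
As [Pi] is onto, the algebra axioms pass from [star] to [mpsi]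
([twisted_algebra]).

The rest follows from comparing the words of the two algebra structures on [T].
Let [star_epi : T -> T] send a word to the [star]-product of its letters.  The
canonical map of [mpsi] is then [Pi \o star_epi] ([canon_epi_twisted]).  The key
fact is [star_epi_tpow]: [star_epi] maps each V^(x)n onto itself.  It holds by
induction on [n]: the [star]-products of a letter with V^(x)n span the image
under multiplication of [psi (V (x) V^(x)n)], and a cochain preserves
V (x) V^(x)n, whose image under multiplication is V^(x)(n+1).  Hence [mpsi] and
[m] have the same image of each V^(x)n; this gives generation by [A1], the
equality of the filtrations and that of the graded components.

For conicity, a kernel is graded if and only if it is stable under the
projections [tproj n] of [T] onto V^(x)n ([conicP]); as [star_epi] commutes with
them, stability passes from the kernel of [Pi] to that of [Pi \o star_epi].
That the components of a conic quantum space form a gradation, and that the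
products of at most [n] generators form a filtration, hold in every quantum
space, hence for [mpsi]. *)

Set Implicit Arguments.
Unset Strict Implicit.
Unset Printing Implicit Defensive.

Import GRing.Theory.

Local Open Scope ring_scope.
Local Open Scope classical_set_scope.

(** * Linear maps and spans *)

Section LinearMaps.
Variables (k : fieldType) (U W : lmodType k) (f : U -> W).
Hypothesis hf : linear f.

Lemma lin0 : f 0 = 0.
Proof. by have := hf (- 1) 0 0; rewrite scaleN1r addNr scaleN1r addNr. Qed.

Lemma linD x y : f (x + y) = f x + f y.
Proof. by have := hf 1 x y; rewrite !scale1r. Qed.

Lemma linZ a x : f (a *: x) = a *: f x.
Proof. by have := hf a x 0; rewrite lin0 !addr0. Qed.

Lemma linB x y : f (x - y) = f x - f y.
Proof. by rewrite linD -!scaleN1r linZ. Qed.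

Lemma lin_sum I (r : seq I) (P : pred I) (F : I -> U) :
  f (\sum_(i <- r | P i) F i) = \sum_(i <- r | P i) f (F i).
Proof. exact: (big_morph f linD lin0). Qed.

End LinearMaps.

Lemma lin_comp (k : fieldType) (U V W : lmodType k) (g : V -> W) (f : U -> V) :
  linear g -> linear f -> linear (g \o f).
Proof. by move=> hg hf a x y /=; rewrite hf hg. Qed.

Lemma lin_factor (k : fieldType) (U V W : lmodType k) (f : U -> V) (g : U -> W) :
  linear f -> linear g -> (forall y, exists x, f x = y) ->
  (forall x, f x = 0 -> g x = 0) ->
  exists h : {linear V -> W}, forall x, h (f x) = g x.
Proof.
move=> hf hg fsurj kfg; have [s fs] := choice fsurj.
have gsE x : g (s (f x)) = g x.
  by apply/subr0_eq; rewrite -linB // kfg // linB // fs subrr.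
(* [g \o s] is linear although the section [s] need not be. *)
have hl : linear (g \o s).
  by move=> a x y /=; rewrite -{1}(fs x) -{1}(fs y) -hf gsE hg.
pose h : {linear V -> W} :=
  HB.pack (g \o s) (GRing.isLinear.Build k V W *:%R (g \o s) hl).
by exists h.
Qed.

Section Spans.
Variables (k : fieldType).
Implicit Types U V W : lmodType k.

Lemma subspace_lspan W (S : set W) : subspace (lspan S).
Proof.
split=> [P [[P0 _] _] //|a x y xS yS P hP].
by case: (hP) => -[_ PD] _; apply: PD; [exact: (xS P) | exact: (yS P)].
Qed.

Lemma sub_lspan W (S : set W) : S `<=` lspan S.
Proof. exact: sub_gen_smallest. Qed.

Lemma lspan_sub W (S P : set W) : subspace P -> S `<=` P -> lspan S `<=` P.
Proof. by move=> hP SP; apply: smallest_sub. Qed.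

Lemma lspan_mono W (S P : set W) : S `<=` P -> lspan S `<=` lspan P.
Proof.
by move=> SP; apply: lspan_sub; [exact: subspace_lspan | move=> x /SP/sub_lspan].
Qed.

Lemma subspace_sum W (S : set W) I (r : seq I) (F : I -> W) :
  subspace S -> (forall i, S (F i)) -> S (\sum_(i <- r) F i).
Proof.
move=> [S0 SD] SF; elim: r => [|i r IHr]; first by rewrite big_nil.
by rewrite big_cons -[F i]scale1r; apply: SD.
Qed.

Lemma subspaceZ W (S : set W) a x : subspace S -> S x -> S (a *: x).
Proof. by move=> [S0 SD] Sx; rewrite -[_ *: _]addr0; apply: SD. Qed.

Lemma subspace_preimage U W (f : U -> W) (S : set W) :
  linear f -> subspace S -> subspace (f @^-1` S).
Proof.
move=> hf [S0 SD]; split=> [|a x y Sx Sy]; first by rewrite /= lin0.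
by rewrite /= hf; apply: SD.
Qed.

Lemma subspace_image U W (f : U -> W) (S : set U) :
  linear f -> subspace S -> subspace (f @` S).
Proof.
move=> hf [S0 SD]; split=> [|a _ _ [x Sx <-] [y Sy <-]].
  by exists 0; rewrite ?lin0.
by exists (a *: x + y); [exact: SD | exact: hf].
Qed.

Lemma subspace_lker U W (f : U -> W) : linear f -> subspace (Defs.lker f).
Proof.
move=> hf; split=> [|a x y]; rewrite /Defs.lker /= ?(lin0 hf) // => fx fy.
by rewrite hf fx fy scaler0 addr0.
Qed.

Lemma image_lspan U W (f : U -> W) (S : set U) :
  linear f -> f @` lspan S = lspan (f @` S).
Proof.
move=> hf; apply/seteqP; split=> [_ [x Sx <-]|].
  apply: (lspan_sub (subspace_preimage hf (subspace_lspan (f @` S)))) Sx.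
  by move=> y Sy; apply: sub_lspan; exists y.
apply: lspan_sub; first exact: subspace_image hf (subspace_lspan S).
by apply: image_subset; apply: sub_lspan.
Qed.

(** This is what reduces an inclusion between products of subspaces to products
of generators, both for the filtration and gradation axioms and for the
subspaces V^(x)r (x) V^(x)s. *)
Lemma lspan_bilinear U V W (b : U -> V -> W) (S : set U) (S' : set V) :
  is_bilinear b ->
  lspan [set b x y | x in lspan S & y in lspan S'] =
  lspan [set b x y | x in S & y in S'].
Proof.
move=> [bl br]; apply/seteqP; split; last first.
  by apply: lspan_mono => _ [x Sx [y Sy <-]]; exists x; [exact: sub_lspan |
    exists y; [exact: sub_lspan |]].
apply: lspan_sub; first exact: subspace_lspan.
set P := (X in _ `<=` X); have hP : subspace P by exact: subspace_lspan.
move=> _ [x Sx [y Sy <-]].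
suff /(_ x Sx) : lspan S `<=` b^~ y @^-1` P by [].
apply: lspan_sub (subspace_preimage (bl y) hP) _ => {Sx}x Sx.
suff /(_ y Sy) : lspan S' `<=` b x @^-1` P by [].
apply: lspan_sub (subspace_preimage (br x) hP) _ => {Sy}y Sy.
by apply: sub_lspan; exists x => //; exists y.
Qed.

Lemma lspan_bigcup_lspan W I (P : set I) (S : I -> set W) :
  lspan (\bigcup_(i in P) lspan (S i)) = lspan (\bigcup_(i in P) S i).
Proof.
apply/seteqP; split; last first.
  by apply: lspan_mono => x [i Pi Sx]; exists i => //; apply: sub_lspan.
apply: lspan_sub (subspace_lspan _) _ => x [i Pi]; apply: lspan_mono => y Sy.
by exists i.
Qed.

End Spans.

(** * Tensor products and the grading of the tensor algebra *)

Section Tensors.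
Variables (k : fieldType).
Implicit Types U V W : lmodType k.

Lemma tensor_ext U V W (f g : tensor U V -> W) : linear f -> linear g ->
  (forall u v, f (tens u v) = g (tens u v)) -> f =1 g.
Proof.
move=> hf hg fg z; have [s ->] := tens_span z.
by rewrite !lin_sum //; apply: eq_bigr.
Qed.

Lemma tmap_bilinear U V U' V' (f : U -> U') (g : V -> V') :
  linear f -> linear g -> is_bilinear (fun u v => tens (f u) (g v)).
Proof.
move=> hf hg; have [tl tr] := tens_bilinear U' V'.
by split=> [v|u] a x y; rewrite ?hf ?hg ?tl ?tr.
Qed.

Lemma tmap_linear U V U' V' (f : U -> U') (g : V -> V') :
  linear f -> linear g -> linear (tmap f g).
Proof. by move=> hf hg; apply/tlift_linear/tmap_bilinear. Qed.

Lemma tmap_tens U V U' V' (f : U -> U') (g : V -> V') u v :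
  linear f -> linear g -> tmap f g (tens u v) = tens (f u) (g v).
Proof. by move=> hf hg; rewrite /tmap tlift_tens //; apply: tmap_bilinear. Qed.

Lemma tmap_surj U V U' V' (f : U -> U') (g : V -> V') :
  linear f -> linear g -> (forall y, exists x, f x = y) ->
  (forall y, exists x, g x = y) -> forall z, exists t, tmap f g t = z.
Proof.
move=> hf hg /choice[s fs] /choice[t gt] z; have [r ->] := tens_span z.
exists (\sum_(p <- r) tens (s p.1) (t p.2)).
rewrite lin_sum; last exact: tmap_linear.
by apply: eq_bigr => p _; rewrite tmap_tens // fs gt.
Qed.

End Tensors.

Section TensorAlgebra.
Variables (k : fieldType) (V : lmodType k).
Notation T := (talg V).

Lemma talg_ext (W : lmodType k) (f g : T -> W) : linear f -> linear g ->
  (forall s, f (tword s) = g (tword s)) -> f =1 g.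
Proof.
move=> hf hg fg x; have [s ->] := tword_span x.
by rewrite !lin_sum //; apply: eq_bigr => p _; rewrite !linZ // fg.
Qed.

Lemma tpow_word s : tpow V (size s) (tword s).
Proof. by apply: sub_lspan; exists s. Qed.

Lemma subspace_tpow n : subspace (tpow V n).
Proof. exact: subspace_lspan. Qed.

Lemma tmul_bilinear : is_bilinear (@tmul k V).
Proof. by case: (talg_algebra V). Qed.

Lemma tjoin_linear : linear (@tjoin k V).
Proof. exact: tlift_linear tmul_bilinear. Qed.

Lemma tjoin_tens x y : tjoin (tens x y) = tmul x y :> T.
Proof. exact: tlift_tens tmul_bilinear. Qed.

(** A word of length [r + s] splits into its first [r] and its last [s]
letters. *)
Lemma tjoin_tpow2 r s : @tjoin k V @` tpow2 V r s = tpow V (r + s).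
Proof.
rewrite /tpow2 lspan_bilinear; last exact: tens_bilinear.
rewrite image_lspan; last exact: tjoin_linear.
congr lspan; apply/seteqP; split=> x.
  move=> [_ [_ [u us <-] [_ [v vs <-] <-]] <-].
  rewrite tjoin_tens tmul_word; exists (u ++ v) => //=.
  by rewrite size_cat us vs.
move=> [w /= ws <-]; exists (tens (tword (take r w)) (tword (drop r w))).
  exists (tword (take r w)).
    by exists (take r w) => //=; rewrite size_takel // ws leq_addr.
  exists (tword (drop r w)) => //.
  by exists (drop r w) => //=; rewrite size_drop ws addKn.
by rewrite tjoin_tens tmul_word cat_take_drop.
Qed.

Definition tproj_word n (s : seq V) : T := if size s == n then tword s else 0.

(** The projection onto V^(x)n along the other tensor powers.  Its being well
defined is the reason why the sum of the tensor powers is direct. *)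
Definition tproj n : T -> T := talift (tproj_word n).

Lemma tproj_word_multilinear n : is_multilinear (tproj_word n).
Proof.
move=> s t a v w; rewrite /tproj_word !size_cat /=.
by case: eqP => _; rewrite ?tword_multilinear // scaler0 addr0.
Qed.

Lemma tproj_linear n : linear (tproj n).
Proof. exact/talift_linear/tproj_word_multilinear. Qed.

Lemma tprojE n s : tproj n (tword s) = if size s == n then tword s else 0.
Proof. exact/talift_word/tproj_word_multilinear. Qed.

Lemma tproj_tpow n x : tpow V n (tproj n x).
Proof.
have [s ->] := tword_span x.
rewrite (lin_sum (tproj_linear n)); apply: subspace_sum (subspace_tpow n) _ => p.
rewrite linZ; last exact: tproj_linear.
apply: subspaceZ (subspace_tpow n) _; rewrite tprojE.
by case: eqP => [<-|_]; [exact: tpow_word | case: (subspace_tpow n)].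
Qed.

Lemma tproj_homog n i x : tpow V i x -> tproj n x = if i == n then x else 0.
Proof.
move=> xi; apply/subr0_eq; move: x xi.
have hl : linear (fun x : T => tproj n x - (if i == n then x else 0)).
  move=> a x y; rewrite tproj_linear scalerBr addrACA -opprD.
  by case: eqP => _; rewrite ?scaler0 ?addr0.
apply: (lspan_sub (subspace_lker hl)) => _ [s <- <-].
by rewrite /Defs.lker /= tprojE subrr.
Qed.

Lemma sum_tproj x : exists N, x = \sum_(i < N) tproj i x.
Proof.
have [s ->] := tword_span x.
have [N ltN] : exists N, forall p, p \in s -> (size p.2 < N)%N.
  exists (\max_(p <- s) size p.2).+1 => p ps; rewrite ltnS.
  exact: (leq_bigmax_seq (F := fun p : k * seq V => size p.2)).
exists N; under [RHS]eq_bigr do rewrite (lin_sum (tproj_linear _)).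
rewrite exchange_big /= !big_seq; apply: eq_bigr => p /ltN lt_pN.
under [RHS]eq_bigr do rewrite (linZ (tproj_linear _)) tprojE.
rewrite (bigD1 (Ordinal lt_pN)) //= eqxx big1 ?addr0 // => i.
by rewrite -val_eqE eq_sym /= => /negPf->; rewrite scaler0.
Qed.

(** The components of a sum of homogeneous elements of distinct degrees are its
terms: this is the independence of the tensor powers. *)
Lemma tproj_sum_homog N (x : 'I_N -> T) : (forall i : 'I_N, tpow V i (x i)) ->
  forall i : 'I_N, tproj i (\sum_(j < N) x j) = x i.
Proof.
move=> xT i; rewrite (lin_sum (tproj_linear _)) (bigD1 i) //=.
rewrite (tproj_homog _ (xT i)) eqxx big1 ?addr0 // => j.
by rewrite -val_eqE => /negPf ji; rewrite (tproj_homog _ (xT j)) ji.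
Qed.

End TensorAlgebra.
Arguments tpow_word {k V} s.
Arguments tproj_tpow {k V} n x.

(** * The canonical map of an algebra on its words *)

Section Products.
Variables (k : fieldType) (V : vectType k).

Section Bilinear.
Variables (A : lmodType k) (mul : A -> A -> A) (one : A).
Variable (inc : {linear V -> A}).
Hypothesis hmul : is_bilinear mul.
Notation wp := (word_prod mul one inc).
Notation Pi := (canon_epi mul one inc).

Lemma word_prod_multilinear : is_multilinear wp.
Proof.
case: hmul => hl hr; elim=> [|u s IHs] t a v w /=; last by rewrite IHs hr.
by rewrite linearP hl.
Qed.

Lemma canon_epi_linear : linear Pi.
Proof. exact/talift_linear/word_prod_multilinear. Qed.

Lemma canon_epi_word s : Pi (tword s) = wp s.
Proof. exact/talift_word/word_prod_multilinear. Qed.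

Lemma canon_componentE n :
  canon_component mul one inc n = lspan [set wp s | s in [set s | size s = n]].
Proof.
rewrite /canon_component /tpow image_lspan; last exact: canon_epi_linear.
congr lspan; apply/seteqP; split=> [_ [_ [s hs <-] <-]|_ [s hs <-]].
  by exists s; rewrite ?canon_epi_word.
by exists (tword s); [exists s | rewrite canon_epi_word].
Qed.

(** The words of length at most [n] span the sum of the tensor powers of degree
at most [n], and their values are the products of at most [n] generators. *)
Lemma prod_filtrationE n :
  prod_filtration mul one inc n = canon_filtration mul one inc n.
Proof.
rewrite /canon_filtration /tpow lspan_bigcup_lspan image_lspan;
  last exact: canon_epi_linear.
congr lspan; apply/seteqP; split=> [_ [s hs <-]|_ [_ [i hi [s hs <-]] <-]].
  exists (tword s); last by rewrite canon_epi_word.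
  by exists (size s) => //; exists s.
by exists s; rewrite /= ?hs // canon_epi_word.
Qed.

(** The kernel is graded exactly when it is stable under the homogeneous
projections: this form of conicity transfers along maps commuting with these.
For the converse, the graded pieces of the kernel are its intersections with
the tensor powers. *)
Lemma conicP : conic mul one inc <->
  forall n x, Pi x = 0 -> Pi (tproj n x) = 0.
Proof.
have hPi := canon_epi_linear; split=> [[I [IT [Isub kerI _]]] n x|kerP].
  have : lspan (\bigcup_n I n) `<=` Defs.lker (Pi \o tproj n).
    apply: lspan_sub; first exact/subspace_lker/lin_comp/tproj_linear.
    move=> y [i _ Iy]; rewrite /Defs.lker /= (tproj_homog _ (IT _ _ Iy)).
    case: eqP => _; last exact: lin0.
    have : lspan (\bigcup_n I n) y by apply: sub_lspan; exists i.
    by rewrite -kerI.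
  by rewrite -kerI; apply.
exists (fun n => tpow V n `&` Defs.lker Pi); split=> [n x [] //|]; split.
- move=> n; have [T0 TD] := subspace_tpow V n.
  have [K0 KD] := subspace_lker hPi.
  by split=> // a x y [? ?] [? ?]; split; [apply: TD | apply: KD].
- apply/seteqP; split; last first.
    by apply: lspan_sub (subspace_lker hPi) _ => x [n _ []].
  move=> x kx; have [N ->] := sum_tproj x.
  apply: subspace_sum (subspace_lspan _) _ => i; apply: sub_lspan.
  by exists (i : nat) => //; split; [exact: tproj_tpow | exact: kerP].
- move=> N x xI x0 i.
  have xT (j : 'I_N) : tpow V j (x j) by have [] := xI j.
  by rewrite -(tproj_sum_homog xT) x0 lin0 //; apply: tproj_linear.
Qed.

End Bilinear.

Section Algebra.
Variables (A : lmodType k) (mul : A -> A -> A) (one : A).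
Variable (inc : {linear V -> A}).
Hypothesis hA : is_algebra mul one.
Notation wp := (word_prod mul one inc).
Notation Pi := (canon_epi mul one inc).

Let hmul : is_bilinear mul. Proof. by case: hA. Qed.

Lemma word_prod_cat s t : wp (s ++ t) = mul (wp s) (wp t).
Proof.
by case: hA => _ mA m1 _; elim: s => [|v s IHs] /=; rewrite ?m1 // IHs mA.
Qed.

Lemma canon_epiM x y : Pi (tmul x y) = mul (Pi x) (Pi y).
Proof.
have [hl hr] := hmul; have [tl tr] := tmul_bilinear V.
have hPi := canon_epi_linear one inc hmul.
move: x; apply: talg_ext => [||s]; [exact: lin_comp | exact: lin_comp (hl _) _ |].
move: y; apply: talg_ext => [||t]; [exact: lin_comp | exact: lin_comp (hr _) _ |].
by rewrite tmul_word !canon_epi_word // word_prod_cat.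
Qed.

(** Generation by [V] thus amounts to the surjectivity of the canonical map. *)
Lemma range_canon_epi : range Pi = smallest (subalgebra mul one) (range inc).
Proof.
have hPi := canon_epi_linear one inc hmul; case: (hA) => _ mA m1 m1r.
apply/seteqP; split=> [_ [x _ <-] S [[Ssub S1 SM] SV]|].
  have [s ->] := tword_span x.
  rewrite (lin_sum hPi); apply: subspace_sum => // p.
  rewrite (linZ hPi); apply: subspaceZ => //.
  rewrite canon_epi_word //; elim: p.2 => //= v t IHt.
  by apply: SM => //; apply: SV; exists v.
apply: smallest_sub => [|_ [v _ <-]]; last first.
  by exists (tword [:: v]); rewrite // canon_epi_word //= m1r.
split=> [||_ _ [x _ <-] [y _ <-]].
- by apply: subspace_image hPi _; split.
- by exists (tword [::]); rewrite // canon_epi_word.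
- by exists (tmul x y); rewrite // canon_epiM.
Qed.

End Algebra.

Section QuantumSpace.
Variables (A : lmodType k) (mul : A -> A -> A) (one : A).
Variable (inc : {linear V -> A}).
Hypothesis hA : quantum_space mul one inc.
Notation Pi := (canon_epi mul one inc).

Let hAlg : is_algebra mul one. Proof. by case: hA. Qed.
Let hmul : is_bilinear mul. Proof. by case: hAlg. Qed.
Let hPi : linear Pi. Proof. exact: canon_epi_linear. Qed.

Lemma canon_epi_surj a : exists x, Pi x = a.
Proof.
have [_ _] := hA; rewrite -range_canon_epi // => PiT.
have : range Pi a by rewrite PiT.
by case=> x _ <-; exists x.
Qed.

Lemma is_filtration_prod : is_filtration mul one (prod_filtration mul one inc).
Proof.
split=> [n|n||| r s x y xr ys].
- exact: subspace_lspan.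
- by apply: lspan_mono => _ [s /= hs <-]; exists s => //=; apply: leqW.
- apply/seteqP; split=> // a _; have [x <-] := canon_epi_surj a.
  have [N ->] := sum_tproj x; exists N => //.
  rewrite prod_filtrationE //; exists (\sum_(i < N) tproj i x) => //.
  apply: subspace_sum (subspace_lspan _) _ => i; apply: sub_lspan.
  by exists (i : nat); [exact: ltnW | exact: tproj_tpow].
- by apply: sub_lspan; exists [::].
- have : lspan [set mul x y | x in prod_filtration mul one inc r
                            & y in prod_filtration mul one inc s] (mul x y).
    by apply: sub_lspan; exists x => //; exists y.
  rewrite lspan_bilinear //; apply: lspan_mono.
  move=> _ [_ [u hu <-] [_ [v hv <-] <-]]; exists (u ++ v).
    by rewrite /= size_cat leq_add.
  exact: word_prod_cat.
Qed.

(** Independence is where conicity enters: a relation between elements of the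
components lifts to an element of the kernel of [Pi], whose homogeneous parts
then lie in the kernel as well. *)
Lemma is_gradation_component : conic mul one inc ->
  is_gradation mul one (canon_component mul one inc).
Proof.
move=> /(conicP one inc hmul) kerP; split=> [||r s x y].
- split=> [n||N x xC x0 i].
  + exact: subspace_image hPi (subspace_tpow V n).
  + apply/seteqP; split=> // a _; have [x <-] := canon_epi_surj a.
    have [N ->] := sum_tproj x.
    rewrite (lin_sum hPi); apply: subspace_sum (subspace_lspan _) _ => i.
    apply: sub_lspan; exists (i : nat) => //.
    by exists (tproj i x) => //; apply: tproj_tpow.
  + have /choice[y yP] : forall j : 'I_N, exists y, tpow V j y /\ Pi y = x j.
      by move=> j; have [y ? ?] := xC j; exists y.
    have yT (j : 'I_N) : tpow V j (y j) by case: (yP j).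
    case: (yP i) => _ <-; rewrite -(tproj_sum_homog yT); apply: kerP.
    by rewrite (lin_sum hPi) -[RHS]x0; apply: eq_bigr => j _; case: (yP j).
- exists (tword [::]); last by rewrite canon_epi_word.
  by apply: sub_lspan; exists [::].
- rewrite !canon_componentE // => xr ys.
  have : lspan [set mul x y | x in canon_component mul one inc r
                            & y in canon_component mul one inc s] (mul x y).
    by apply: sub_lspan; exists x; rewrite ?canon_componentE //; exists y;
      rewrite ?canon_componentE.
  rewrite !canon_componentE // lspan_bilinear //; apply: lspan_mono.
  move=> _ [_ [u hu <-] [_ [v hv <-] <-]]; exists (u ++ v).
    by rewrite /= size_cat hu hv.
  exact: word_prod_cat.
Qed.

End QuantumSpace.

End Products.

(** * The twisted product on the tensor algebra *)

Lemma is_algebra_image (k : fieldType) (A B : lmodType k)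
    (mulA : A -> A -> A) (oneA : A) (mulB : B -> B -> B) (f : A -> B) :
  is_algebra mulA oneA -> is_bilinear mulB -> (forall b, exists a, f a = b) ->
  (forall x y, mulB (f x) (f y) = f (mulA x y)) -> is_algebra mulB (f oneA).
Proof.
move=> [_ mA m1 m1r] hB fsurj fM; split=> // [x y z|x|x].
- have [[a <-] [b <-] [c <-]] := And3 (fsurj x) (fsurj y) (fsurj z).
  by rewrite !fM mA.
- by have [a <-] := fsurj x; rewrite fM m1.
- by have [a <-] := fsurj x; rewrite fM m1r.
Qed.

Section TwistedTensorAlgebra.
Variables (k : fieldType) (V : vectType k).
Notation T := (talg V).
Variable psi : {linear tensor T T -> tensor T T}.

Definition tletter (v : V) : T := tword [:: v].

Lemma tletter_linear : linear tletter.
Proof. by move=> a v w; apply: (tword_multilinear [::]). Qed.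

HB.instance Definition _ :=
  GRing.isLinear.Build k V T *:%R tletter tletter_linear.

(** The twisted product before passing to the quotient: [m_psi] for the free
quantum space on [V]. *)
Definition star (x y : T) : T := tjoin (psi (tens x y)).

(** The canonical map of the quantum space [T] with the product [star].  It is
usually not the identity, since the [star]-product of the letters of a word
differs from the word. *)
Definition star_epi : T -> T := canon_epi star (tone V) tletter.

Lemma star_bilinear : is_bilinear star.
Proof.
have [tl tr] := tens_bilinear T T.
by split=> [y|x] a u v; rewrite /star ?tl ?tr linearP tjoin_linear.
Qed.

Hypothesis hpsi : counital_cocycle2 psi.

(** On words, the cocycle identity is associativity after evaluating the tensor
products of maps. *)
Lemma star_algebra : is_algebra star (tone V).
Proof.
case: hpsi => _ hcoc hunit; have [sl sr] := star_bilinear.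
have hpl : linear psi by exact: linearP.
have hid : linear (@id T) by [].
have hj : linear (@tjoin k V) by exact: tjoin_linear.
split=> [|x y z|x|x]; first exact: star_bilinear.
- move: x; apply: talg_ext => [||r]; first exact: sl.
    by move=> a u v /=; rewrite !sl.
  move: y; apply: talg_ext => [||s].
  + by move=> a u v /=; rewrite sl sr.
  + by move=> a u v /=; rewrite sr sl.
  move: z; apply: talg_ext => [||t]; [|exact: sr|].
    by move=> a u v /=; rewrite !sr.
  have := hcoc _ _ _ _ _ _ (tpow_word r) (tpow_word s) (tpow_word t).
  by rewrite !tmap_tens //= => ->.
- have [e1 _] := hunit x; rewrite /star e1 tjoin_tens.
  by case: (talg_algebra V) => _ _ ->.
- have [_ e1] := hunit x; rewrite /star e1 tjoin_tens.
  by case: (talg_algebra V) => _ _ _ ->.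
Qed.

(** The key fact: in each degree the [star]-products of letters span what the
words span.  In degree [n + 1] the [star]-products [v * w], with [v] a letter
and [w] a [star]-product of [n] letters, span the image of V (x) V^(x)n under
[psi] followed by multiplication; [psi] preserves V (x) V^(x)n, so this is
V^(x)(n+1). *)
Lemma star_epi_tpow n : star_epi @` tpow V n = tpow V n.
Proof.
case: hpsi => -[_ hpow] _ _; have hs := star_bilinear.
have hsp : linear (@tjoin k V \o psi).
  by apply: lin_comp; [exact: tjoin_linear | exact: linearP].
rewrite -[LHS]/(canon_component star (tone V) tletter n).
elim: n => [|n IHn]; rewrite canon_componentE //.
  congr lspan; apply/seteqP; split=> _ [s s0 <-]; exists s => //;
    by rewrite (size0nil s0).
(* The factor of degree 1 stays spanned by letters, while the induction
   hypothesis turns the factor of degree [n] into [star]-products. *)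
rewrite -add1n -tjoin_tpow2 -hpow image_comp /tpow2 -IHn.
rewrite canon_componentE // lspan_bilinear; last exact: tens_bilinear.
rewrite image_lspan //; congr lspan; apply/seteqP; split=> x.
  move=> [[//|v s] [/= hs0] <-]; exists (tens (tletter v)
    (word_prod star (tone V) tletter s)) => //.
  exists (tletter v); first by exists [:: v].
  by exists (word_prod star (tone V) tletter s) => //; exists s.
move=> [_ [_ [[//|v [|//]] _ <-] [_ [s hs0 <-] <-]] <-].
by exists (v :: s) => //=; rewrite /= hs0.
Qed.

Lemma star_epi_tproj n x : star_epi (tproj n x) = tproj n (star_epi x).
Proof.
have he : linear star_epi by exact: canon_epi_linear star_bilinear.
have hp : linear (@tproj k V n) by exact: tproj_linear.
move: x; apply: talg_ext => [||s]; [exact: lin_comp | exact: lin_comp hp he |].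
have : tpow V (size s) (star_epi (tword s)).
  by rewrite -star_epi_tpow; exists (tword s) => //; apply: tpow_word.
by move=> /tproj_homog ->; rewrite tprojE; case: eqP => // _; rewrite lin0.
Qed.

Lemma star_epi_surj x : exists y, star_epi y = x.
Proof.
have [N ->] := sum_tproj x.
have /choice[y yP] : forall i : 'I_N, exists y, star_epi y = tproj i x.
  move=> i; have := tproj_tpow i x; rewrite -star_epi_tpow.
  by case=> y _ <-; exists y.
exists (\sum_(i < N) y i).
rewrite lin_sum; last exact: canon_epi_linear star_bilinear.
by apply: eq_bigr.
Qed.

End TwistedTensorAlgebra.

(** * The twisted product on a quantum space *)

Section TwistedAlgebra.
Variables (k : fieldType) (V : vectType k) (A : lmodType k).
Variables (m : A -> A -> A) (eta : A) (inc : {linear V -> A}).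
Hypothesis hA : quantum_space m eta inc.
Notation T := (talg V).
Variable psi : {linear tensor T T -> tensor T T}.
Hypothesis hpsi : counital_cocycle2 psi.
Notation Pi := (canon_epi m eta inc).

Let hm : is_bilinear m. Proof. by case: hA => -[]. Qed.
Let hPi : linear Pi. Proof. exact: canon_epi_linear. Qed.

Lemma induced_exists : admissible Pi psi -> exists Psi, induced Pi psi Psi.
Proof.
move=> hadm; apply: lin_factor (tmap_linear hPi hPi) _ _ _.
- by apply: lin_comp (tmap_linear hPi hPi) _; apply: linearP.
- by apply: tmap_surj => //; apply: canon_epi_surj.
- move=> z kz; have : Defs.lker (tmap Pi Pi) (psi z) by rewrite -hadm; exists z.
  by [].
Qed.

Variable Psi : {linear tensor A A -> tensor A A}.
Hypothesis hPsi : induced Pi psi Psi.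
Notation mpsi := (twisted m Psi).

(** [Pi] is multiplicative from [star] to [m_psi], as both come from [psi] and
[Pi] is multiplicative for the original products. *)
Lemma twisted_canon_epi x y : mpsi (Pi x) (Pi y) = Pi (star psi x y).
Proof.
rewrite /twisted -tmap_tens // hPsi /star; move: (psi _).
have hml := tlift_linear hm.
have hj : linear (@tjoin k V) by exact: tjoin_linear.
apply: tensor_ext => [||u v].
- by apply: lin_comp => //; apply: tmap_linear.
- exact: lin_comp.
- by rewrite tmap_tens // tlift_tens // tjoin_tens canon_epiM //; case: hA.
Qed.

Lemma twisted_bilinear : is_bilinear mpsi.
Proof.
have [tl tr] := tens_bilinear A A; have hml := tlift_linear hm.
by split=> [y|x] a u v; rewrite /twisted ?tl ?tr linearP hml.
Qed.

Lemma twisted_algebra : is_algebra mpsi eta.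
Proof.
have -> : eta = Pi (tone V) by rewrite canon_epi_word.
apply: is_algebra_image (star_algebra hpsi) twisted_bilinear _ _.
  exact: canon_epi_surj.
exact: twisted_canon_epi.
Qed.

(** Passing from [m] to [m_psi] changes the canonical map only by the degreewise
surjective map [star_epi], which is why the images of the tensor powers do not
change. *)
Lemma canon_epi_twisted x : canon_epi mpsi eta inc x = Pi (star_epi psi x).
Proof.
have hmpsi := twisted_bilinear; have hs := star_bilinear psi.
have he := canon_epi_linear (tone V) (@tletter k V) hs.
move: x; apply: talg_ext => [||s]; [exact: canon_epi_linear | exact: lin_comp |].
rewrite /star_epi !canon_epi_word //; elim: s => [|v s IHs] /=.
  by rewrite canon_epi_word.
rewrite -twisted_canon_epi -IHs canon_epi_word //=.
by case: hA => -[_ _ _ ->].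
Qed.

Lemma twisted_quantum_space : quantum_space mpsi eta inc.
Proof.
have hB := twisted_algebra; split=> //; first by case: hA.
rewrite -range_canon_epi //; apply/seteqP; split=> // a _.
have [x <-] := canon_epi_surj hA a; have [y <-] := star_epi_surj hpsi x.
by exists y; rewrite // canon_epi_twisted.
Qed.

Lemma canon_epi_twisted_image S :
  canon_epi mpsi eta inc @` S = Pi @` (star_epi psi @` S).
Proof.
by rewrite image_comp; apply: eq_imagel => x _; apply: canon_epi_twisted.
Qed.

Lemma twisted_component n :
  canon_component mpsi eta inc n = canon_component m eta inc n.
Proof. by rewrite /canon_component canon_epi_twisted_image star_epi_tpow. Qed.

Lemma twisted_filtration n :
  canon_filtration mpsi eta inc n = canon_filtration m eta inc n.
Proof.
rewrite /canon_filtration canon_epi_twisted_image; congr (_ @` _).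
rewrite image_lspan; last exact: canon_epi_linear (star_bilinear psi).
rewrite image_bigcup; congr lspan; apply: eq_bigcupr => i _.
exact: star_epi_tpow.
Qed.

Lemma twisted_conic : conic m eta inc -> conic mpsi eta inc.
Proof.
move=> /(conicP eta inc hm) kerP.
apply/(conicP eta inc twisted_bilinear) => n x.
by rewrite !canon_epi_twisted star_epi_tproj //; apply: kerP.
Qed.

End TwistedAlgebra.

Theorem theorem8 (R : realType) (k : fieldType)
    (hk : k = (R : fieldType) \/ k = (R[i] : fieldType))
    (A1 : vectType k) (A : lmodType k) (m : A -> A -> A) (eta : A)
    (inc : {linear A1 -> A}) (hA : quantum_space m eta inc)
    (psi : {linear tensor (talg A1) (talg A1) -> tensor (talg A1) (talg A1)})
    (hpsi : counital_cocycle2 psi)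
    (hadm : admissible (canon_epi m eta inc) psi) :
  (exists Psi : {linear tensor A A -> tensor A A},
     induced (canon_epi m eta inc) psi Psi) /\
  forall Psi : {linear tensor A A -> tensor A A},
    induced (canon_epi m eta inc) psi Psi ->
    let mpsi := twisted m Psi in
    [/\ quantum_space mpsi eta inc,
        is_filtration mpsi eta (prod_filtration mpsi eta inc),
        (forall n, prod_filtration mpsi eta inc n =
                   canon_filtration m eta inc n)
      & conic m eta inc ->
        [/\ conic mpsi eta inc,
            is_gradation mpsi eta (canon_component mpsi eta inc)
          & forall n, canon_component mpsi eta inc n =
                      canon_component m eta inc n]].
Proof.
split=> [|Psi hPsi mpsi]; first exact: induced_exists.
have hQ : quantum_space mpsi eta inc by exact: twisted_quantum_space hPsi.
split=> // [|n|hc].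
- exact: is_filtration_prod.
- rewrite prod_filtrationE; last exact: twisted_bilinear hA _.
  exact: twisted_filtration hPsi n.
- have hc' : conic mpsi eta inc by exact: twisted_conic hPsi hc.
  split=> // [|n]; first exact: is_gradation_component.
  exact: twisted_component hPsi n.
Qed.
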